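(* Let $d, n \in \mathbb{N}$ with $n \ge 1$, let $\{\chi_{\bm{s}} : \bm{s} \in \mathbb{R}^d\}$ be an isotropic functional random field with values in $\mathcal{H} = L^2([0,1])$ and trace-covariogram $h \mapsto \sigma_{\mathrm{tr}}(h)$, where $\sigma_{\mathrm{tr}}(0) > 0$, and let $\bm{s}_1, \dots, \bm{s}_n, \bm{s}_{n+1} \in \mathbb{R}^d$. For $m \in \{n, n+1\}$ let $$\mathrm{ESS}_{\mathcal{F}}^{(m)} = m^2\, \sigma_{\mathrm{tr}}(0) \left( \sum_{i=1}^m \sum_{j=1}^m \sigma_{\mathrm{tr}}(\|\bm{s}_i - \bm{s}_j\|) \right)^{-1}$$ be the functional effective sample size based on $\chi_{\bm{s}_1}, \dots, \chi_{\bm{s}_m}$. Suppose that $\chi_{\bm{s}_{n+1}}$ is independent of the sample $(\chi_{\bm{s}_1}, \dots, \chi_{\bm{s}_n})$ and that the trace-covariogram is non-negative, i.e. $\sigma_{\mathrm{tr}}(h) \ge 0$ for all $h \ge 0$. Then $$\mathrm{ESS}_{\mathcal{F}}^{(n+1)} > \mathrm{ESS}_{\mathcal{F}}^{(n)}.$$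
   Context: Let $\mathcal{H} = L^2([0,1])$ be the real Hilbert space with inner product $\langle f, g\rangle = \int_0^1 f(t) g(t)\,dt$ and norm $\|f\|_{\mathcal{H}} = \langle f,f\rangle^{1/2}$; $\|\cdot\|$ denotes the Euclidean norm on $\mathbb{R}^d$. A functional random field on $\mathbb{R}^d$ is a collection $\{\chi_{\bm{s}} : \bm{s} \in \mathbb{R}^d\}$ of $\mathcal{H}$-valued random variables. When $E[\|\chi_{\bm{s}}\|_{\mathcal{H}}] < \infty$, the mean function $\mu_{\bm{s}} \in \mathcal{H}$ is defined by $E[\langle \chi_{\bm{s}}, f\rangle] = \langle \mu_{\bm{s}}, f\rangle$ for all $f \in \mathcal{H}$. When $E[\|\chi_{\bm{s}}\|_{\mathcal{H}}^2] < \infty$ for all $\bm{s}$, the covariance operators are $C_{\bm{s}_1,\bm{s}_2}(f) = E[\langle \chi_{\bm{s}_1} - \mu_{\bm{s}_1}, f\rangle (\chi_{\bm{s}_2} - \mu_{\bm{s}_2})]$, $f \in \mathcal{H}$. The field is weakly stationary if $E[\|\chi_{\bm{s}}\|_{\mathcal{H}}^2] < \infty$ for all $\bm{s}$, $\mu_{\bm{s}} = \mu$ does not depend on $\bm{s}$, and $C_{\bm{s}_1,\bm{s}_2}$ depends on $\bm{s}_1,\bm{s}_2$ only through $\bm{s}_1 - \bm{s}_2$; it is isotropic if it is weakly stationary and $C_{\bm{s}_1,\bm{s}_2}$ depends on $\bm{s}_1,\bm{s}_2$ only through $\|\bm{s}_1 - \bm{s}_2\|$. The operator $C_{\bm{s}_1,\bm{s}_2}$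 has kernel $\sigma_{\bm{s}_1,\bm{s}_2}(t,u) = \mathrm{cov}[\chi_{\bm{s}_1}(t), \chi_{\bm{s}_2}(u)]$. The trace-covariogram is $$\sigma_{\mathrm{tr}}(\bm{s}_1,\bm{s}_2) = E[\langle \chi_{\bm{s}_1} - \mu_{\bm{s}_1}, \chi_{\bm{s}_2} - \mu_{\bm{s}_2}\rangle] = \int_0^1 \sigma_{\bm{s}_1,\bm{s}_2}(t,t)\,dt,$$ which under isotropy depends only on $h = \|\bm{s}_1 - \bm{s}_2\|$ and is written $\sigma_{\mathrm{tr}}(h)$. *)

(* Defs.v *)
From HB Require Import structures.
From mathcomp Require Import all_boot all_order all_algebra.
From mathcomp Require Import all_classical all_reals all_analysis measurable_realfun.

Set Implicit Arguments.
Unset Strict Implicit.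
Unset Printing Implicit Defensive.

Import Order.TTheory GRing.Theory Num.Theory.
Import numFieldNormedType.Exports.
Local Open Scope classical_set_scope.
Local Open Scope ring_scope.
Local Open Scope quotient_scope.

Section L2_space.
Variable R : realType.

Definition leb01 : set (measurableTypeR R) -> \bar R :=
  mrestr (@lebesgue_measure R) (measurable_itv `[0, 1]).
HB.instance Definition _ := Measure.on leb01.

Let leb01_setT : leb01 setT = 1%E.
Proof.
rewrite /leb01 /mrestr setTI lebesgue_measure_itv/= lte_fin ltr01.
by rewrite sube0.
Qed.
HB.instance Definition _ := Measure_isProbability.Build _ _ _ leb01 leb01_setT.

Local Notation mu := (leb01 : {measure set (measurableTypeR R) -> \bar R}).
Local Notation sqint := (LfunType mu (lee1n 2)).
Local Notation mfunT := {mfun measurableTypeR R >-> measurableTypeR R}.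
Local Notation cls := {mfun_ mu, measurableTypeR R >-> measurableTypeR R}.

(* L^2([0,1]): elements are a.e.-equivalence classes of square-integrable
   functions; the coercion to functions picks a representative. Functions are
   defined on all of R, but leb01 does not see what happens outside [0,1]. *)
Definition L2 : Type := LspaceType2 mu.
HB.instance Definition _ := gen_eqMixin L2.
HB.instance Definition _ := gen_choiceMixin L2.

Definition L2_fun (f : L2) : R -> R :=
  aqEqMfun_to_fun (LebesgueSpace.sort f).
Coercion L2_fun : L2 >-> Funclass.

Lemma L2_ext (f g : L2) : (f = g %[ae mu]) -> f = g.
Proof.
move=> fg.
have {}fg : LebesgueSpace.sort f = LebesgueSpace.sort g.
  rewrite -(reprK (LebesgueSpace.sort f)) -(reprK (LebesgueSpace.sort g)).
  exact/eqmodP/asboolP.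
case: f g fg => [f [[fP]]] [g [[gP]]]/= fg.
by move: gP; rewrite -fg => gP; rewrite (Prop_irrelevance fP gP).
Qed.

Let to_mfun (f : sqint) : mfunT :=
  HB.pack (f : R -> R) (isMeasurableFun.Build _ _ (measurableTypeR R)
    (measurableTypeR R) (f : R -> R) (@measurable_funPT _ _ _ _ f)).

Let cls_ae (f : mfunT) : aqEqMfun_to_fun (\pi_cls f) = f %[ae mu].
Proof.
have : repr (\pi_cls f) = f %[mod cls] by rewrite reprK.
by move=> /eqmodP/asboolP.
Qed.

Let Lnorm2_ae (f g : measurableTypeR R -> R) : measurable_fun setT f ->
  measurable_fun setT g -> (f = g %[ae mu]) ->
  'N[mu]_2%:E[EFin \o f]%E = 'N[mu]_2%:E[EFin \o g]%E.
Proof.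
have mN (h : measurableTypeR R -> R) : measurable_fun setT h ->
    measurable_fun setT (fun x => `|(EFin \o h) x| `^ 2 : \bar R)%E.
  move=> mh; apply: (@measurableT_comp _ _ _ _ _ _ (fun x => x `^ 2)%E).
    exact: measurable_poweR.
  by apply: measurableT_comp => //; exact/measurable_EFinP.
move=> mf mg fg; rewrite unlock /Lnorm; congr (_ `^ _)%E.
apply: ge0_ae_eq_integral => //; [exact: mN|exact: mN| | |].
- by move=> x _; exact: poweR_ge0.
- by move=> x _; exact: poweR_ge0.
- by move: fg; apply: filterS => x /= fx _; rewrite fx.
Qed.

Let cls_finite (f : sqint) :
  finite_norm mu 2%:E (aqEqMfun_to_fun (\pi_cls (to_mfun f))).
Proof.
rewrite /finite_norm (Lnorm2_ae _ _ (cls_ae (to_mfun f))).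
- exact: Lfunction_finite.
- exact: (@measurable_funPT _ _ _ _ (repr (\pi_cls (to_mfun f)))).
- exact: (@measurable_funPT _ _ _ _ f).
Qed.

Definition toL2 (f : sqint) : L2 :=
  LebesgueSpace.Pack (LebesgueSpace.Class
    (isFinLebesgue.Build _ _ _ _ _ (lee1n 2)
      (\pi_cls (to_mfun f)) (cls_finite f))).

Lemma toL2_ae (f : sqint) : toL2 f = f %[ae mu].
Proof. exact: cls_ae. Qed.

Lemma L2_fun_Lfun (f : L2) : (f : R -> R) \in Lfun mu 2%:E.
Proof.
rewrite inE; apply/andP; split; rewrite inE/=.
  exact: (@measurable_funPT _ _ _ _ (repr (LebesgueSpace.sort f))).
by case: f => f [[]].
Qed.

Definition ofL2 (f : L2) : sqint := Lfun_Sub (lee1n 2) (L2_fun_Lfun f).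

Lemma ofL2K : cancel ofL2 toL2.
Proof. by move=> f; apply: L2_ext; exact: toL2_ae. Qed.

Lemma toL2_eq (f g : sqint) : (f = g %[ae mu]) -> toL2 f = toL2 g.
Proof.
move=> fg; apply: L2_ext; apply: ae_eq_trans (toL2_ae f) _.
by apply: ae_eq_trans fg _; apply: ae_eq_sym; exact: toL2_ae.
Qed.

Let L2_0 : L2 := toL2 0.
Let L2_opp (f : L2) : L2 := toL2 (- ofL2 f).
Let L2_add (f g : L2) : L2 := toL2 (ofL2 f + ofL2 g).
Let L2_scale (a : R) (f : L2) : L2 := toL2 (a *: ofL2 f).

Let toL2D f g : L2_add (toL2 f) (toL2 g) = toL2 (f + g).
Proof.
apply: toL2_eq; have := toL2_ae f; have := toL2_ae g.
apply: (filterS2 (F := almost_everywhere mu)) => x /= gx fx _.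
by rewrite -[RHS]/(f x + g x) -fx// -gx.
Qed.
Let toL2N f : L2_opp (toL2 f) = toL2 (- f).
Proof.
apply: toL2_eq; have := toL2_ae f.
apply: (filterS (F := almost_everywhere mu)) => x /= fx _.
by rewrite -[RHS]/(- f x) -fx.
Qed.
Let toL2Z a f : L2_scale a (toL2 f) = toL2 (a *: f).
Proof.
apply: toL2_eq; have := toL2_ae f.
apply: (filterS (F := almost_everywhere mu)) => x /= fx _.
by rewrite -[RHS]/(a * f x) -fx.
Qed.

Let L2_addA : associative L2_add.
Proof.
by move=> f g h; rewrite -(ofL2K f) -(ofL2K g) -(ofL2K h) !toL2D addrA.
Qed.
Let L2_addC : commutative L2_add.
Proof. by move=> f g; rewrite -(ofL2K f) -(ofL2K g) !toL2D addrC. Qed.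
Let L2_add0 : left_id L2_0 L2_add.
Proof. by move=> f; rewrite -(ofL2K f) toL2D add0r. Qed.
Let L2_addN : left_inverse L2_0 L2_opp L2_add.
Proof. by move=> f; rewrite -(ofL2K f) toL2N toL2D addNr. Qed.
HB.instance Definition _ :=
  GRing.isZmodule.Build L2 L2_addA L2_addC L2_add0 L2_addN.

Let L2_scaleA a b f : L2_scale a (L2_scale b f) = L2_scale (a * b) f.
Proof. by rewrite -(ofL2K f) !toL2Z scalerA. Qed.
Let L2_scale1 : left_id 1 L2_scale.
Proof. by move=> f; rewrite -(ofL2K f) toL2Z scale1r. Qed.
Let L2_scaleDr : right_distributive L2_scale +%R.
Proof.
move=> a f g; rewrite -(ofL2K f) -(ofL2K g) [in LHS]/GRing.add/= toL2D !toL2Z.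
by rewrite scalerDr -toL2D.
Qed.
Let L2_scaleDl f : {morph L2_scale^~ f : a b / a + b}.
Proof. by move=> a b; rewrite -(ofL2K f) !toL2Z scalerDl -toL2D. Qed.
HB.instance Definition _ := GRing.Zmodule_isLmodule.Build R L2
  L2_scaleA L2_scale1 L2_scaleDr L2_scaleDl.

Lemma L2_addE (f g : L2) : f + g = f \+ g %[ae mu].
Proof. exact: toL2_ae. Qed.
Lemma L2_scaleE a (f : L2) : a *: f = a \*: (f : R -> R) %[ae mu].
Proof. exact: toL2_ae. Qed.

(* Independent of the representatives, as an integral. *)
Definition inner (f g : L2) : R := \int[mu]_t (f t * g t).

Let L2_norm (f : L2) : R := Num.sqrt (inner f f).

Let L2_normE f : L2_norm f = fine 'N[mu]_2%:E[EFin \o f]%E.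
Proof.
rewrite /L2_norm /inner /Rintegral unlock /Lnorm.
have -> : (\int[mu]_t (f t * f t)%:E = \int[mu]_t (`|(EFin \o f) t| `^ 2))%E.
  apply: eq_integral => t _.
  by rewrite poweR_EFin powR_mulrn// -normrX ger0_norm ?sqr_ge0// expr2.
rewrite poweR12_sqrt; last by apply: integral_ge0 => t _; exact: poweR_ge0.
by case: (integral _ _ _) => //=; rewrite sqrtr0.
Qed.

Let L2_norm_ae (f : L2) (g : sqint) : (f = g %[ae mu]) ->
  L2_norm f = fine 'N[mu]_2%:E[EFin \o g]%E.
Proof.
move=> fg; rewrite L2_normE (Lnorm2_ae _ _ fg)//.
exact: (@measurable_funPT _ _ _ _ (ofL2 f)).
Qed.

Let L2_ler_normD f g : L2_norm (f + g) <= L2_norm f + L2_norm g.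
Proof.
rewrite (L2_norm_ae (g := ofL2 f + ofL2 g)) ?ler_LnormD//; last exact: toL2_ae.
rewrite (L2_norm_ae (f := f) (g := ofL2 f)); last exact: ae_eq_refl.
rewrite (L2_norm_ae (f := g) (g := ofL2 g)); last exact: ae_eq_refl.
exact: ler_LnormD.
Qed.

Let L2_normrZ a f : L2_norm (a *: f) = `|a| * L2_norm f.
Proof.
rewrite (L2_norm_ae (g := a *: ofL2 f)); last exact: toL2_ae.
rewrite (L2_norm_ae (f := f) (g := ofL2 f)); last exact: ae_eq_refl.
have := LnormZ (ofL2 f) a.
by rewrite -(finite_norm_fine (ofL2 f)) -EFinM => /(congr1 fine).
Qed.

Let L2_normr0_eq0 f : L2_norm f = 0 -> f = 0.
Proof.
rewrite (L2_norm_ae (f := f) (g := ofL2 f)); last exact: ae_eq_refl.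
move=> /fine_Lnormr_eq0 f0; rewrite -(ofL2K f); exact: toL2_eq.
Qed.

HB.instance Definition _ := Lmodule_isNormed.Build R L2
  L2_ler_normD L2_normrZ L2_normr0_eq0.

Lemma L2_norm_inner (f : L2) : `|f| = Num.sqrt (inner f f).
Proof. by []. Qed.

(* Borel sigma-algebra of the norm topology *)
HB.instance Definition _ :=
  Measurable.copy L2 (g_sigma_algebraType (@open L2)).
End L2_space.

(* The library norm on row vectors is the sup norm. *)
Definition enorm (R : realType) d (x : 'rV[R]_d) : R :=
  Num.sqrt (\sum_(i < d) x 0 i ^+ 2).

Section functional_random_variables.
Context {R : realType} {dO : measure_display} {Omega : measurableType dO}.
Variable P : probability Omega R.

(* The weak (Pettis) characterization E<X, f> = <m, f> of the mean of X. *)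
Definition is_mean (X : Omega -> L2 R) (m : L2 R) : Prop :=
  ('E_P[fun w => `|X w|%R] < +oo)%E /\
  forall f : L2 R, ('E_P[fun w => inner (X w) f] = (inner m f)%:E)%E.

(* The element m such that is_mean X m, which is unique; 0 if there is none. *)
Definition mean (X : Omega -> L2 R) : L2 R := xget 0 (is_mean X).

(* C f = E[<X - mean X, f> (Y - mean Y)] for all f, the expectation on the
   right being that of an L2-valued random variable. *)
Definition is_covop (X Y : Omega -> L2 R) (C : L2 R -> L2 R) : Prop :=
  forall f : L2 R,
    is_mean (fun w => inner (X w - mean X) f *: (Y w - mean Y)) (C f).

Definition trace_cov (X Y : Omega -> L2 R) : R :=
  fine 'E_P[fun w => inner (X w - mean X)%R (Y w - mean Y)%R]%E.

Definition independent_RV d1 d2 (T1 : measurableType d1)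
    (T2 : measurableType d2) (X : Omega -> T1) (Y : Omega -> T2) : Prop :=
  forall (A : set T1) (B : set T2), measurable A -> measurable B ->
    P ((X @^-1` A) `&` (Y @^-1` B)) = (P (X @^-1` A) * P (Y @^-1` B))%E.

End functional_random_variables.

Section functional_random_field.
Context {R : realType} {dO : measure_display} {Omega : measurableType dO}.
Context {P : probability Omega R} {d : nat}.
Variable chi : 'rV[R]_d -> {RV P >-> L2 R}.

Definition weakly_stationary : Prop :=
  [/\ forall s, ('E_P[fun w => (`|chi s w| ^+ 2)%R] < +oo)%E,
      exists mu, forall s, is_mean P (chi s) mu &
      exists C : 'rV[R]_d -> L2 R -> L2 R,
        forall s1 s2, is_covop P (chi s1) (chi s2) (C (s1 - s2))].

Definition isotropic : Prop :=
  weakly_stationary /\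
  exists C : R -> L2 R -> L2 R,
    forall s1 s2, is_covop P (chi s1) (chi s2) (C (enorm (s1 - s2))).

(* The common value of trace_cov (chi s1) (chi s2) over all s1, s2 at distance
   h; it is well defined when chi is isotropic. The default 0 is only used when
   no two points are at distance h: h < 0, or d = 0 and h != 0. *)
Definition trace_covariogram (h : R) : R :=
  xget 0 [set v | exists s1 s2, enorm (s1 - s2) = h /\
                                v = trace_cov P (chi s1) (chi s2)].

Definition ESS (m : nat) (s : 'I_m -> 'rV[R]_d) : R :=
  m%:R ^+ 2 * trace_covariogram 0 *
  (\sum_(i < m) \sum_(j < m) trace_covariogram (enorm (s i - s j)))^-1.

End functional_random_field.

(* Main.v *)
Require Import Defs.
From HB Require Import structures.
From mathcomp Require Import all_boot all_order all_algebra.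
From mathcomp Require Import all_classical all_reals all_analysis measurable_realfun.
From mathcomp Require Import ring lra.

Set Implicit Arguments.
Unset Strict Implicit.
Unset Printing Implicit Defensive.

Import Order.TTheory GRing.Theory Num.Theory.
Import numFieldNormedType.Exports.
Local Open Scope classical_set_scope.
Local Open Scope ring_scope.

(* Let [s0] be the independent location. Independence makes the covariance
   operator of [chi s_i] and [chi s0] vanish, and by isotropy the operator of
   every pair of points at the same distance vanishes too. A vanishing operator
   has zero trace, so the trace-covariogram is [0] at the distances
   [|s_i - s0|]. Hence passing from [n] to [n + 1] points only adds [sigma 0] to
   the double sum [S], while [S >= n * sigma 0] because the diagonal contributes
   [n * sigma 0] and the other terms are nonnegative; the inequality
   [n ^ 2 / S < (n + 1) ^ 2 / (S + sigma 0)] follows.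

   The trace of a covariance operator is reached without an orthonormal basis:
   the orthogonal projections onto the step functions with mesh [1 / (n + 1)]
   converge strongly to the identity of L^2([0,1]), so [<U, V>] is a dominated
   limit of linear combinations of products [<U, f> * <V, f>]. *)

(** * Elementary inequalities and limits *)

(** Pythagoras with one leg dropped: gives both the optimality and the contractivity of orthogonal
    projections. *)
Lemma le_of_sqrD (R : realFieldType) (x y z : R) :
  0 <= x -> 0 <= y -> y ^+ 2 = x ^+ 2 + z ^+ 2 -> x <= y.
Proof.
move=> x0 y0 yxz; rewrite -(@ler_pXn2r _ 2)// ?nnegrE//.
by rewrite yxz lerDl sqr_ge0.
Qed.

Lemma mulr_le_sqrD (R : realFieldType) (a b : R) :
  0 <= a -> 0 <= b -> a * b <= a ^+ 2 + b ^+ 2.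
Proof. by move=> a0 b0; nra. Qed.

Lemma cvg_norm0P (R : realFieldType) (V : normedZmodType R) (u : nat -> V) :
  `|u n| @[n --> \oo] --> (0 : R) <->
  (forall e, 0 < e -> \forall n \near \oo, `|u n| < e).
Proof.
by split=> [/cvgrPdist_lt uP|uP]; [|apply/cvgrPdist_lt]; move=> e /uP;
  apply: filterS => n; rewrite sub0r normrN normr_id.
Qed.

(** * The inner product of L^2([0,1]) *)

Section inner_product.
Context {R : realType}.
Implicit Types (f g h : L2 R) (a : R).
Local Notation mu := (@leb01 R : {measure set (measurableTypeR R) -> \bar R}).

Lemma measurable_L2 f :
  measurable_fun setT (f : measurableTypeR R -> measurableTypeR R).
Proof. exact: (@measurable_funPT _ _ _ _ (ofL2 f)). Qed.

Lemma inner_integrable f g :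
  mu.-integrable setT (EFin \o (fun t => f t * g t)).
Proof.
by apply/Lfun1_integrable; apply: Lfun2_mul_Lfun1; exact: L2_fun_Lfun.
Qed.

(** Sums and multiples in [L2] agree with the pointwise ones only almost everywhere, so bilinearity
    of [inner] passes through this. *)
Lemma ae_eq_Rintegral (u v : measurableTypeR R -> measurableTypeR R) :
  measurable_fun setT u -> measurable_fun setT v ->
  (\forall t \ae mu, u t = v t) ->
  \int[mu]_t u t = \int[mu]_t v t.
Proof.
move=> mu_ mv uv; congr fine; apply: ae_eq_integral => //.
- exact/measurable_EFinP.
- exact/measurable_EFinP.
- by apply: filterS uv => t /= -> _.
Qed.

Lemma innerC f g : inner f g = inner g f.
Proof. by apply: eq_Rintegral => t _; rewrite mulrC. Qed.

Lemma innerDl f g h : inner (f + g) h = inner f h + inner g h.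
Proof.
rewrite /inner -RintegralD//; try exact: inner_integrable.
apply: ae_eq_Rintegral.
- by apply: measurable_funM; exact: measurable_L2.
- by apply: measurable_funD; apply: measurable_funM; exact: measurable_L2.
- by apply: filterS (L2_addE f g) => t /(_ Logic.I) fgt;
    exact: etrans (congr1 (fun x => x * h t) fgt) (mulrDl _ _ _).
Qed.

Lemma innerZl a f g : inner (a *: f) g = a * inner f g.
Proof.
rewrite /inner -RintegralZl//; last exact: inner_integrable.
apply: ae_eq_Rintegral.
- by apply: measurable_funM; exact: measurable_L2.
- by apply: measurable_funM => //; apply: measurable_funM; exact: measurable_L2.
- by apply: filterS (L2_scaleE a f) => t /(_ Logic.I) aft;
    exact: etrans (congr1 (fun x => x * g t) aft) (esym (mulrA _ _ _)).
Qed.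

Lemma inner0l g : inner 0 g = 0.
Proof. by rewrite -(scale0r g) innerZl mul0r. Qed.

Lemma innerNl f g : inner (- f) g = - inner f g.
Proof. by rewrite -scaleN1r innerZl mulN1r. Qed.

Lemma innerBl f g h : inner (f - g) h = inner f h - inner g h.
Proof. by rewrite innerDl innerNl. Qed.

Lemma inner_suml (I : finType) (u : I -> L2 R) h :
  inner (\sum_i u i) h = \sum_i inner (u i) h.
Proof.
by elim/big_ind2: _ => [|f1 g1 f2 g2 <- <-|//]; rewrite ?inner0l ?innerDl.
Qed.

Lemma inner0r f : inner f 0 = 0.
Proof. by rewrite innerC inner0l. Qed.

Lemma innerDr f g h : inner f (g + h) = inner f g + inner f h.
Proof. by rewrite innerC innerDl !(innerC _ f). Qed.

Lemma innerBr f g h : inner f (g - h) = inner f g - inner f h.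
Proof. by rewrite innerC innerBl !(innerC _ f). Qed.

Lemma innerZr a f g : inner f (a *: g) = a * inner f g.
Proof. by rewrite innerC innerZl innerC. Qed.

Lemma inner_sumr (I : finType) (u : I -> L2 R) h :
  inner h (\sum_i u i) = \sum_i inner h (u i).
Proof. by rewrite innerC inner_suml; apply: eq_bigr => i _; rewrite innerC. Qed.

Lemma inner_ge0 f : 0 <= inner f f.
Proof. by apply: Rintegral_ge0 => t _; rewrite -expr2 sqr_ge0. Qed.

Lemma inner_self f : inner f f = `|f| ^+ 2.
Proof. by rewrite L2_norm_inner sqr_sqrtr// inner_ge0. Qed.

(** Cauchy-Schwarz: expanding the squared norm of [|g| *: f - |f| *: g] gives
    [2 |f| |g| (|f| |g| - inner f g) >= 0], and [|f| |g|] is positive once the zero cases are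
    removed. *)
Lemma inner_le f g : inner f g <= `|f| * `|g|.
Proof.
have [->|f0] := eqVneq f 0; first by rewrite inner0l normr0 mul0r.
have [->|g0] := eqVneq g 0; first by rewrite inner0r normr0 mulr0.
have f_gt0 : 0 < `|f| by rewrite normr_gt0.
have g_gt0 : 0 < `|g| by rewrite normr_gt0.
have := inner_ge0 (`|g| *: f - `|f| *: g).
rewrite !(innerBl, innerBr, innerZl, innerZr) (innerC g f) !inner_self => H.
have : 0 <= (`|f| * `|g|) * (2 * (`|f| * `|g| - inner f g)).
  by apply: le_trans H _; rewrite le_eqVlt; apply/orP; left; apply/eqP; ring.
by rewrite pmulr_rge0 ?mulr_gt0// pmulr_rge0// subr_ge0.
Qed.

Lemma normr_inner_le f g : `|inner f g| <= `|f| * `|g|.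
Proof.
by rewrite ler_norml inner_le lerNl -innerNl andbT -(normrN f) inner_le.
Qed.

Lemma normD_sqr f g : inner f g = 0 -> `|f + g| ^+ 2 = `|f| ^+ 2 + `|g| ^+ 2.
Proof.
by move=> fg; rewrite -!inner_self innerDl !innerDr (innerC g) fg addr0 add0r.
Qed.

End inner_product.

(** * Projection onto the span of a finite orthogonal family *)

Section orthogonal_projection.
Context {R : realType} {I : finType}.
Variable u : I -> L2 R.
Hypothesis u_orth : forall i j, i != j -> inner (u i) (u j) = 0.
Implicit Types f g : L2 R.

(* Some [u i] may be [0]; the coefficient is then [0 / 0 = 0]. *)
Definition orth_proj f : L2 R :=
  \sum_i (inner f (u i) / inner (u i) (u i)) *: u i.

(** This makes [f - orth_proj f] orthogonal to the span of the [u i]. *)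
Lemma orth_proj_inner f i : inner (orth_proj f) (u i) = inner f (u i).
Proof.
rewrite /orth_proj inner_suml (bigD1 i)//= big1 ?addr0; last first.
  by move=> j ji; rewrite innerZl (u_orth ji) mulr0.
rewrite innerZl; have [u0|u0] := eqVneq (inner (u i) (u i)) 0; last by rewrite divfK.
suff -> : u i = 0 by rewrite !inner0r mulr0.
by apply/eqP; rewrite -normr_eq0 -sqrf_eq0 -inner_self u0.
Qed.

(** The vector [orth_proj f - \sum_i a i *: u i] lies in the span, hence is orthogonal to
    [f - orth_proj f]. *)
Let pyth f (a : I -> R) :
  `|f - \sum_i a i *: u i| ^+ 2 =
  `|f - orth_proj f| ^+ 2 + `|orth_proj f - \sum_i a i *: u i| ^+ 2.
Proof.
have orth (b : I -> R) : inner (f - orth_proj f) (\sum_i b i *: u i) = 0.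
  rewrite inner_sumr big1// => i _.
  by rewrite innerZr innerBl orth_proj_inner subrr mulr0.
set h := \sum_i _; have fh : inner (f - orth_proj f) (orth_proj f - h) = 0.
  by rewrite innerBr !orth subr0.
rewrite (_ : f - h = (f - orth_proj f) + (orth_proj f - h)); last by rewrite subrKA.
exact: normD_sqr.
Qed.

Lemma orth_proj_best f (a : I -> R) :
  `|f - orth_proj f| <= `|f - \sum_i a i *: u i|.
Proof. exact: le_of_sqrD (normr_ge0 _) (normr_ge0 _) (pyth f a). Qed.

(** This is [pyth] with all coefficients zero. *)
Lemma norm_orth_proj f : `|orth_proj f| <= `|f|.
Proof.
have := pyth f (fun=> 0); rewrite big1; last by move=> i _; rewrite scale0r.
rewrite !subr0 addrC; exact: le_of_sqrD (normr_ge0 _) (normr_ge0 _).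
Qed.

End orthogonal_projection.

(** * Almost everywhere calculus and dominated convergence in L^2([0,1]) *)

Section step_approximation.
Context {R : realType}.
Implicit Types (f g : L2 R).
Local Notation mu := (@leb01 R : {measure set (measurableTypeR R) -> \bar R}).
Local Notation mR := (measurableTypeR R).
Local Notation aeS := (filterS (F := almost_everywhere mu)).
Local Notation aeS2 := (filterS2 (F := almost_everywhere mu)).
Local Notation aeS3 := (filterS3 (F := almost_everywhere mu)).

Lemma leb01_fin : (mu setT < +oo)%E.
Proof. by rewrite /= probability_setT ltry. Qed.

Lemma ae_leb01_itv : \forall t \ae mu, t \in `[0, 1].
Proof.
exists (~` `[0, 1]); split.
- exact: measurableC.
- rewrite /= /leb01 /mrestr setICl; exact: measure0.
- by move=> t /= t01; rewrite in_itv/=; exact: t01.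
Qed.

Lemma bounded_Lfun2 (h : mR -> mR) (M : R) : measurable_fun setT h ->
  (forall t, `|h t| <= M) -> (h : R -> R) \in Lfun mu 2%:E.
Proof.
move=> mh hM; rewrite inE; apply/andP; split; rewrite inE//=.
rewrite /finite_norm unlock /Lnorm; apply: poweR_lty.
apply: (@le_lt_trans _ _ (\int[mu]_t (M ^+ 2)%:E)%E).
  apply: ge0_le_integral => //.
  - by move=> x _; exact: poweR_ge0.
  - apply: (@measurableT_comp _ _ _ _ _ _ (fun x => x `^ 2)%E).
      exact: measurable_poweR.
    by apply: measurableT_comp => //; exact/measurable_EFinP.
  - move=> t _; rewrite poweR_EFin powR_mulrn// lee_fin.
    by rewrite ler_pXn2r// ?nnegrE// (le_trans _ (hM t)).
by rewrite integral_cst// lte_mul_pinfty// ?leb01_fin// lee_fin sqr_ge0.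
Qed.

Definition to_L2 (h : R -> R) (hL : h \in Lfun mu 2%:E) : L2 R :=
  toL2 (Lfun_Sub (lee1n 2) hL).

Lemma to_L2_ae (h : R -> R) (hL : h \in Lfun mu 2%:E) :
  \forall t \ae mu, to_L2 hL t = h t.
Proof.
have := toL2_ae (Lfun_Sub (lee1n 2) hL).
apply: aeS => t /(_ Logic.I).
by rewrite Lfun_valP.
Qed.

(** Allows norms to be computed with an explicit function instead of the chosen representative. *)
Lemma norm_L2_integral f (h : mR -> mR) : measurable_fun setT h ->
  (\forall t \ae mu, f t = h t) ->
  (`|f| ^+ 2)%:E = (\int[mu]_t (h t ^+ 2)%:E)%E.
Proof.
move=> mh fh; rewrite -inner_self /inner /Rintegral fineK; last first.
  by apply: integrable_fin_num => //; exact: inner_integrable.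
apply: ae_eq_integral => //.
- by apply/measurable_EFinP/measurable_funM; exact: measurable_L2.
- by apply/measurable_EFinP/measurable_funX.
- by move: fh; apply: aeS => t -> _; rewrite expr2.
Qed.

(** Dominated convergence applies to the squares, with bound [g ^ 2]; continuity of the square root
    then returns to the norms. *)
Lemma L2_dominated_cvg0 (f_ : nat -> L2 R) (g : L2 R) :
  (\forall t \ae mu, forall n, `|f_ n t| <= `|g t|) ->
  (\forall t \ae mu, f_ n t @[n --> \oo] --> (0 : R)) ->
  `|f_ n| @[n --> \oo] --> (0 : R).
Proof.
move=> fg f0.
have mf n : measurable_fun setT (fun t => (f_ n t ^+ 2)%:E).
  apply/measurable_EFinP.
  by apply: (measurable_funX (f := f_ n : mR -> mR)); exact: measurable_L2.
have [||_ _] := @dominated_convergence _ _ _ mu setT measurableT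
  (fun n t => (f_ n t ^+ 2)%:E) (cst 0)%E (EFin \o (fun t => g t * g t))
  mf (measurable_cst _) _ (inner_integrable g g) _.
- move: f0; apply: aeS => t ft0 _.
  have H : f_ n t ^+ 2 @[n --> \oo] --> (0 : R).
    by rewrite -(mul0r 0); under eq_fun do rewrite expr2; apply: cvgM.
  by apply: cvg_EFin; first exact: nearW.
- move: fg; apply: aeS => t ftg n _ /=.
  rewrite lee_fin normrX -expr2 -(real_normK (num_real (g t))).
  by rewrite ler_pXn2r ?nnegrE.
rewrite integral0.
have E n : (\int[mu]_t (f_ n t ^+ 2)%:E = (`|f_ n| ^+ 2)%:E)%E.
  by rewrite (norm_L2_integral (measurable_L2 (f_ n)))//; apply: nearW.
under eq_fun do rewrite E.
move=> /fine_cvg/= H.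
rewrite (_ : (fun n => `|f_ n|) = (fun n => Num.sqrt (`|f_ n| ^+ 2))); last first.
  by apply/funext => n; rewrite sqrtr_sqr normr_id.
by rewrite -sqrtr0; exact: (continuous_cvg _ (@sqrt_continuous R 0) H).
Qed.

(** Transfers integrals to Lebesgue measure on [0,1], where continuous functions approximate
    integrable ones. *)
Lemma integral_leb01 (h : mR -> \bar R) : measurable_fun setT h ->
  (forall t, 0 <= h t)%E ->
  (\int[mu]_t h t = \int[@lebesgue_measure R]_(t in `[0%R, 1%R]) h t)%E.
Proof.
move=> mh h0.
rewrite (ge0_negligible_integral (N := ~` (`[0%R, 1%R]%classic : set mR)))//.
- rewrite setTD setCK; apply: eq_measure_integral => A mA A01.
  by rewrite /= /leb01 /mrestr setIidl.
- exact: measurableC.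
- by rewrite /= /leb01 /mrestr setICl measure0.
Qed.

Lemma L2_add_ae f g : \forall t \ae mu, L2_fun (f + g) t = f t + g t.
Proof. by have := L2_addE f g; apply: aeS => t; exact. Qed.

Lemma L2_scale_ae (a : R) f : \forall t \ae mu, L2_fun (a *: f) t = a * f t.
Proof. by have := L2_scaleE a f; apply: aeS => t; exact. Qed.

Lemma L2_sub_ae f g : \forall t \ae mu, L2_fun (f - g) t = f t - g t.
Proof.
rewrite -scaleN1r; have := L2_scale_ae (-1) g; have := L2_add_ae f ((-1) *: g).
by apply: aeS2 => t -> ->; rewrite mulN1r.
Qed.

Lemma L2_sum_ae (I : Type) (r : seq I) (u : I -> L2 R) (h : I -> R -> R) :
  (forall i, \forall t \ae mu, u i t = h i t) ->
  \forall t \ae mu, L2_fun (\sum_(i <- r) u i) t = \sum_(i <- r) h i t.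
Proof.
move=> uh; elim: r => [|i r IH].
  rewrite big_nil; have := L2_scale_ae 0 (0 : L2 R); rewrite scale0r.
  by apply: aeS => t ->; rewrite big_nil mul0r.
rewrite big_cons; have := L2_add_ae (u i) (\sum_(j <- r) u j).
have := uh i; move: IH; apply: aeS3.
by move=> t hr hi ->; rewrite big_cons hi hr.
Qed.

(** * Truncation and approximation by bounded continuous functions *)

Definition clamp (M x : R) := Num.max (- M) (Num.min M x).

Lemma clamp_bound M x : 0 <= M -> `|clamp M x| <= M.
Proof.
by move=> M0; rewrite ler_norml /clamp le_max lexx/= ge_max ge_min lexx/= ge0_cp.
Qed.

Lemma clamp_lip M x y : `|clamp M x - clamp M y| <= `|x - y|.
Proof.
have := ler_norm (x - y); have := ler_norm (y - x); rewrite distrC.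
(* The absolute value becomes a variable known only through two linear bounds, so that every case is
   linear arithmetic. *)
move: `|x - y| => d; rewrite /clamp ler_norml.
have [] := leP M x; have [] := leP M y; have [] := leP (- M) M;
  have [] := leP (- M) x; have [] := leP (- M) y; lra.
Qed.

Lemma clamp_id M x : `|x| <= M -> clamp M x = x.
Proof. by rewrite ler_norml => /andP[Nx xM]; rewrite /clamp min_r// max_r. Qed.

Lemma continuous_clamp M : continuous (clamp M).
Proof.
move=> x; rewrite /clamp.
apply: (@continuous_max R R (cst (- M)) (fun x => Num.min M x));
  first exact: cst_continuous.
by apply: (@continuous_min R R (cst M) id); [exact: cst_continuous|].
Qed.

Lemma measurable_clamp M (h : mR -> mR) : measurable_fun setT h ->
  measurable_fun setT (fun t => clamp M (h t) : mR).
Proof.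
move=> mh; apply: (@measurableT_comp _ _ _ _ _ _ (clamp M : mR -> mR)) => //.
exact: (continuous_measurable_fun (@continuous_clamp M)).
Qed.

Lemma clamp_sub_le (M x : R) : 0 <= M -> `|x - clamp M x| <= `|x|.
Proof.
move=> M0; have := ler_norm x; have := ler_norm (- x); rewrite normrN.
move: `|x| => d; rewrite /clamp ler_norml.
by have [] := leP M x; have [] := leP (- M) M; have [] := leP (- M) x; lra.
Qed.

Lemma clamp_Lfun2 (h : mR -> mR) (M : R) : 0 <= M -> measurable_fun setT h ->
  ((fun t => clamp M (h t)) : R -> R) \in Lfun mu 2%:E.
Proof.
move=> M0 mh; apply: (@bounded_Lfun2 (fun t => clamp M (h t) : mR) M).
  exact: measurable_clamp.
by move=> t; exact: clamp_bound.
Qed.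

(** The remainders [f - clamp n f] are dominated by [|f|] and vanish at [t] once [n >= |f t|]. *)
Lemma L2_truncation f (e : R) : 0 < e ->
  exists n, `|f - to_L2 (clamp_Lfun2 (ler0n _ n) (measurable_L2 f))| < e.
Proof.
move=> e0; pose f_ n : L2 R := f - to_L2 (clamp_Lfun2 (ler0n _ n) (measurable_L2 f)).
have f_E : \forall t \ae mu, forall n, f_ n t = f t - clamp n%:R (f t).
  apply/ae_foralln => n.
  have := to_L2_ae (clamp_Lfun2 (ler0n _ n) (measurable_L2 f)).
  have := L2_sub_ae f (to_L2 (clamp_Lfun2 (ler0n _ n) (measurable_L2 f))).
  by apply: aeS2 => t fE cE; rewrite /f_ fE cE.
have /cvg_norm0P /(_ e e0) [N _ /(_ N (leqnn N))] :
    `|f_ n| @[n --> \oo] --> (0 : R); last by exists N.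
  apply: (@L2_dominated_cvg0 _ f).
    move: f_E; apply: aeS => t fE n.
    by rewrite fE clamp_sub_le.
  move: f_E; apply: aeS => t fE; apply/cvgrPdist_lt => d d0.
  near=> n; rewrite fE clamp_id ?subrr ?subr0 ?normr0//.
  by near: n; exact: nbhs_infty_ger.
Unshelve. all: end_near. Qed.

Lemma lebesgue01_fin : (@lebesgue_measure R `[0%R, 1%R]%classic < +oo)%E.
Proof. by rewrite lebesgue_measure_itv/= lte_fin ltr01 sube0 ltry. Qed.

(* Density is available in L^1 only; truncating both functions at [M] turns
   this into L^2, as |clamp M x - clamp M y|^2 <= 2 M |x - y|. *)
Lemma continuous_bounded_dense f (e : R) : 0 < e ->
  exists (h : R -> R) (M : R) (hL : h \in Lfun mu 2%:E),
    [/\ continuous h, forall t, `|h t| <= M & `|f - to_L2 hL| < e].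
Proof.
move=> e0; have e20 : 0 < e / 2 by rewrite divr_gt0.
have [n fn] := L2_truncation f e20.
set M : R := n%:R; have M0 : 0 <= M by exact: ler0n.
pose phi : mR -> mR := fun t => clamp M (f t).
have mphi : measurable_fun setT phi by apply: measurable_clamp; exact: measurable_L2.
have phiM t : `|phi t| <= M by exact: clamp_bound.
have intphi : (@lebesgue_measure R).-integrable `[0, 1] (EFin \o phi).
  apply: measurable_bounded_integrable => //.
  - exact: lebesgue01_fin.
  - exact: measurable_funTS.
  - exists M; split; first exact: num_real.
    by move=> x Mx t _; exact: le_trans (phiM t) (ltW Mx).
have [|g_ [cg _ gphi]] :=
  approximation_continuous_integrable (measurable_itv `[0, 1]) _ intphi.
  exact: lebesgue01_fin.
(* This choice gives [2 * M * d < (e / 2) ^ 2]; the [+ 1] keeps the denominator positive when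
   [M = 0]. *)
pose d : R := (e / 2) ^+ 2 / (2 * M + 1).
have d0 : 0 < d by rewrite divr_gt0 ?exprn_gt0// ltr_wpDl// mulr_ge0.
have [k dk] : exists k, (\int[@lebesgue_measure R]_(z in `[0%R, 1%R])
    `|(phi z - g_ k z)%:E| < d%:E)%E.
  have /gphi[k _ /(_ k (leqnn k)) gk] : nbhs (0%:E : \bar R) [set x | (x < d%:E)%E].
    by apply: open_nbhs_nbhs; split; [exact: open_ereal_lt_ereal|rewrite /= lte_fin].
  by exists k.
have mg : measurable_fun setT (g_ k : mR -> mR).
  exact: (continuous_measurable_fun (cg k)).
exists (fun t => clamp M (g_ k t)), M, (clamp_Lfun2 M0 mg); split.
- move=> t; apply: (@continuous_comp _ _ _ (g_ k) (clamp M)); first exact: cg.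
  exact: continuous_clamp.
- by move=> t; exact: clamp_bound.
set fM := to_L2 _ in fn; set g := to_L2 _.
(* The path from [f] to [g] goes through the truncation [fM]: the first half is [fn], the second is
   the L^1 estimate. *)
rewrite -(subrKA fM) (splitr e); apply: le_lt_trans (ler_normD _ _) _.
apply: ltrD => //.
rewrite -(@ltr_pXn2r _ 2)// ?nnegrE ?(ltW e20)// -lte_fin.
pose psi : mR -> mR := fun t => phi t - clamp M (g_ k t).
have mpsi : measurable_fun setT psi.
  by apply: measurable_funB => //; exact: measurable_clamp.
rewrite (@norm_L2_integral _ psi)//; last first.
  have := to_L2_ae (clamp_Lfun2 M0 mg).
  have := to_L2_ae (clamp_Lfun2 (ler0n R n) (measurable_L2 f)).
  have := L2_sub_ae fM g.
  by apply: aeS3 => t -> -> ->.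
apply: (@le_lt_trans _ _ ((2 * M)%:E * \int[mu]_t `|(phi t - g_ k t)%:E|)%E).
  rewrite -ge0_integralZl//; last first.
  - by rewrite lee_fin mulr_ge0.
  - by apply: measurableT_comp => //; apply/measurable_EFinP; exact: measurable_funB.
  apply: ge0_le_integral => //.
  - by move=> t _; rewrite lee_fin sqr_ge0.
  - by apply/measurable_EFinP; exact: measurable_funX.
  - by apply: measurable_funeM; apply: measurableT_comp => //;
      apply/measurable_EFinP; exact: measurable_funB.
  - move=> t _; rewrite -EFinM lee_fin -real_normK ?num_real// expr2.
    apply: ler_pM => //.
      apply: le_trans (ler_normB _ _) _.
      by rewrite mulr2n mulrDl mul1r lerD// clamp_bound.
    (* [phi] is its own clamp, so [clamp_lip] bounds the second factor by the distance to [g_ k]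
       itself. *)
    by have := clamp_lip M (phi t) (g_ k t); rewrite (clamp_id (phiM t)).
rewrite integral_leb01//.
  apply: (@le_lt_trans _ _ ((2 * M)%:E * d%:E)%E).
    by apply: lee_wpmul2l; rewrite ?lee_fin ?mulr_ge0// ltW.
  have dM : (e / 2) ^+ 2 = 2 * M * d + d.
    rewrite -{2}[d]mul1r -mulrDl /d [RHS]mulrC divfK//.
    by rewrite gt_eqF// ltr_wpDl// mulr_ge0.
  by rewrite -EFinM lte_fin dM ltrDl.
by apply: measurableT_comp => //; apply/measurable_EFinP; exact: measurable_funB.
Qed.

(** * Step functions on a regular mesh *)

(* The last cell [1, 1 + 1 / (n + 1)[ is only there to cover the endpoint [1]. *)
Definition cell (n : nat) (k : 'I_n.+2) : set mR :=
  `[k%:R / n.+1%:R, k.+1%:R / n.+1%:R[%classic.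

Lemma cellP n (k : 'I_n.+2) (t : R) :
  cell k t <-> k%:R <= t * n.+1%:R < k.+1%:R.
Proof.
by rewrite /cell/= in_itv/= ler_pdivrMr ?ltr0Sn// ltr_pdivlMr ?ltr0Sn.
Qed.

Lemma cell_inj n (k j : 'I_n.+2) (t : R) : cell k t -> cell j t -> k = j.
Proof.
move=> /cellP /andP[k1 k2] /cellP /andP[j1 j2]; apply/val_inj/eqP.
have := le_lt_trans k1 j2; have := le_lt_trans j1 k2.
by rewrite !ltr_nat !ltnS => jk kj; rewrite eqn_leq jk kj.
Qed.

Lemma cell_cover n (t : R) : t \in `[0, 1] -> exists k : 'I_n.+2, cell k t.
Proof.
rewrite in_itv/= => /andP[t0 t1].
have tn0 : 0 <= t * n.+1%:R by rewrite mulr_ge0.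
(* The index is the integer part of [t * n.+1]; it reaches [n.+1] at [t = 1], hence the bound
   [n.+2]. *)
have kn : (Num.truncn (t * n.+1%:R) < n.+2)%N.
  rewrite -(ltr_nat R); apply: le_lt_trans (_ : n.+1%:R < _);
    last by rewrite ltr_nat.
  apply: (@le_trans _ _ (t * n.+1%:R)); first by rewrite truncn_le.
  by rewrite ler_piMl.
by exists (Ordinal kn); apply/cellP => /=; exact: truncn_itv.
Qed.

Lemma cell_Lfun2 n (k : 'I_n.+2) : (\1_(cell k) : R -> R) \in Lfun mu 2%:E.
Proof.
apply: (@bounded_Lfun2 (\1_(cell k) : mR -> mR) 1).
  by apply: measurable_indic; exact: measurable_itv.
by move=> t; rewrite indicE ger0_norm// lern1 leq_b1.
Qed.

(** The last cell meets [0,1] only at the point 1, so its class is [0]: this is the degenerate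
    vector that [orth_proj] tolerates. *)
Definition cell_L2 n (k : 'I_n.+2) : L2 R := to_L2 (cell_Lfun2 k).

Lemma cell_L2_orth n (j k : 'I_n.+2) : j != k -> inner (cell_L2 j) (cell_L2 k) = 0.
Proof.
move=> jk; rewrite /inner (@ae_eq_Rintegral _ _ (cst 0))//.
- by rewrite Rintegral_cst// mul0r.
- by apply: measurable_funM; exact: measurable_L2.
- have := to_L2_ae (cell_Lfun2 j); have := to_L2_ae (cell_Lfun2 k).
  apply: aeS2 => t jt kt; rewrite /cell_L2 jt kt !indicE /=.
  have [tj|tj] := boolP (t \in cell j); last by rewrite mul0r.
  have [tk|tk] := boolP (t \in cell k); last by rewrite mulr0.
  by move: jk; rewrite (cell_inj (set_mem tj) (set_mem tk)) eqxx.
Qed.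

(** Almost every [t] lies within the mesh of its sampling point, so continuity at [t] gives
    pointwise convergence; the constant [2 * M] dominates. *)
Lemma step_cvg (h : R -> R) (M : R) (hL : h \in Lfun mu 2%:E) :
  continuous h -> (forall t, `|h t| <= M) ->
  `|to_L2 hL - \sum_(k < n.+2) h (k%:R / n.+1%:R) *: cell_L2 k|
    @[n --> \oo] --> (0 : R).
Proof.
move=> ch hM; have M0 : 0 <= M by exact: le_trans (hM 0).
have cL : (cst (2 * M) : R -> R) \in Lfun mu 2%:E.
  apply: (@bounded_Lfun2 (cst (2 * M) : mR -> mR) (2 * M)) => // t /=.
  by rewrite ger0_norm// mulr_ge0.
pose d_ n : L2 R := to_L2 hL - \sum_(k < n.+2) h (k%:R / n.+1%:R) *: cell_L2 k.
have dE : \forall t \ae mu, forall n, L2_fun (d_ n) t =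
    h t - \sum_(k < n.+2) h (k%:R / n.+1%:R) * \1_(cell k) t.
  apply/ae_foralln => n.
  have := to_L2_ae hL.
  have : \forall t \ae mu,
      L2_fun (\sum_(k < n.+2) h (k%:R / n.+1%:R) *: cell_L2 k) t =
      \sum_(k < n.+2) h (k%:R / n.+1%:R) * \1_(cell k) t.
    apply: (L2_sum_ae _ (h := fun (k : 'I_n.+2) (t : R) =>
      h (k%:R / n.+1%:R) * \1_(cell k) t)) => k.
    have := to_L2_ae (cell_Lfun2 k).
    have := L2_scale_ae (h (k%:R / n.+1%:R)) (cell_L2 k).
    by apply: aeS2 => t -> ->.
  have := L2_sub_ae (to_L2 hL) (\sum_(k < n.+2) h (k%:R / n.+1%:R) *: cell_L2 k).
  by apply: aeS3 => t -> -> ->.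
(* For [t] in [0,1] exactly one cell contains [t], so a single term of the sum survives. *)
have {dE} dE : \forall t \ae mu, forall n, exists k : 'I_n.+2,
    cell k t /\ L2_fun (d_ n) t = h t - h (k%:R / n.+1%:R).
  have := ae_leb01_itv; move: dE; apply: aeS2 => t dE t01 n.
  have [k kt] := cell_cover n t01; exists k; split => //.
  rewrite dE (bigD1 k)//= big1 ?addr0 ?indicE ?mem_set// ?mulr1// => j jk.
  rewrite indicE; have [tj|tj] := boolP (t \in cell j); last by rewrite mulr0.
  by move: jk; rewrite (cell_inj (set_mem tj) kt) eqxx.
apply: (@L2_dominated_cvg0 d_ (to_L2 cL)).
  have := to_L2_ae cL; move: dE; apply: aeS2 => t dE cE n.
  have [k [_ ->]] := dE n; rewrite cE/= (ger0_norm (mulr_ge0 _ M0))//.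
  by rewrite (le_trans (ler_normB _ _))// mulr2n mulrDl mul1r lerD.
move: dE; apply: aeS => t dE; apply/cvgrPdist_lt => e e0.
have /cvgrPdist_lt /(_ e e0) := ch t.
move=> /nbhs_ballP[r /= r0 hr].
near=> n; have [k [kt ->]] := dE n.
rewrite sub0r normrN; apply: hr; rewrite /ball/=.
move/cellP: kt => /andP[k1 k2].
have n0 : 0 < n.+1%:R :> R by rewrite ltr0Sn.
have rn : n.+1%:R^-1 < r.
  by near: n; exact: (near_infty_natSinv_lt (PosNum r0)).
rewrite ger0_norm ?subr_ge0 ?ler_pdivrMr// ltrBlDl.
apply: (@lt_trans _ _ (k.+1%:R / n.+1%:R)); first by rewrite ltr_pdivlMr.
by rewrite -natr1 mulrDl mul1r ltrD2l.
Unshelve. all: end_near. Qed.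

Definition step_proj n f : L2 R := orth_proj (@cell_L2 n) f.

(** By [orth_proj_best] the projection is at least as close to [f] as the step function sampling a
    continuous [h] near [f]. *)
Lemma step_proj_cvg f : `|f - step_proj n f| @[n --> \oo] --> (0 : R).
Proof.
apply/cvg_norm0P => e e0; have e20 : 0 < e / 2 by rewrite divr_gt0.
have [h [M [hL [ch hM fh]]]] := continuous_bounded_dense f e20.
have /cvg_norm0P /(_ _ e20) := step_cvg hL ch hM.
apply: filterS => n hn.
apply: le_lt_trans
  (orth_proj_best (@cell_L2_orth n) f (fun k => h (k%:R / n.+1%:R))) _.
rewrite -(subrKA (to_L2 hL)) (splitr e).
by apply: le_lt_trans (ler_normD _ _) _; exact: ltrD.
Qed.

End step_approximation.

(** * Expectation of a product of independent real variables *)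

Section independent_product.
Context {R : realType} {dO : measure_display} {Omega : measurableType dO}.
Variable P : probability Omega R.

(** Independence identifies the law of [(X, Y)] with the product of the laws, since they agree on
    rectangles; Fubini then separates the factors. *)
Lemma expectationM_independent (X Y : {RV P >-> R}) :
  independent_RV P X Y ->
  P.-integrable setT (EFin \o X) -> P.-integrable setT (EFin \o Y) ->
  P.-integrable setT (fun w => (X w * Y w)%:E) ->
  ('E_P[fun w => (X w * Y w)%R] = 'E_P[X] * 'E_P[Y])%E.
Proof.
move=> indXY iX iY iXY; rewrite unlock.
have mXY : measurable_fun setT (fun w => (X w, Y w)).
  exact: measurable_fun_pair.
pose XY : {mfun Omega >-> (R * R)%type} :=
  MeasurableFun.Pack (MeasurableFun.Class (isMeasurableFun.Build _ _ _ _ _ mXY)).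
pose f (z : R * R) := (z.1 * z.2)%:E.
have mf : measurable_fun setT f by apply/measurable_EFinP; exact: measurable_funM.
have prodE A : measurable A ->
    (distribution P X \x distribution P Y)%E A = distribution P XY A.
  by move=> mA; apply: product_measure_unique => // B C mB mC; exact: indXY.
have fXY : (\int[distribution P X \x distribution P Y]_z f z
    = \int[P]_w (X w * Y w)%:E)%E.
  rewrite (eq_measure_integral (distribution P XY)); last first.
    by move=> A mA _; exact: prodE.
  by rewrite integral_distribution.
rewrite -fXY -integral12_prod_meas1; last first.
  apply/integrableP; split => //.
  rewrite (eq_measure_integral (distribution P XY)); last first.
    by move=> A mA _; exact: prodE.
  rewrite ge0_integral_distribution//; last exact: measurableT_comp.
  by case/integrableP: iXY.
have mid : measurable_fun setT (EFin : R -> \bar R) by exact/measurable_EFinP.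
rewrite /fubini_F /f /=.
have idX : (distribution P X).-integrable setT EFin.
  exact: integrable_pushforward.
have idY : (distribution P Y).-integrable setT EFin.
  exact: integrable_pushforward.
under eq_integral do (under eq_integral do rewrite EFinM; rewrite integralZl//).
have fY : (\int[P]_w (Y w)%:E)%E \is a fin_num by exact: integrable_fin_num.
rewrite (_ : \int[distribution P Y]_y y%:E = \int[P]_w (Y w)%:E)%E; last first.
  by rewrite integral_distribution.
by rewrite -(fineK fY) integralZr//= integral_distribution.
Qed.

End independent_product.

(** * From scalar covariances to the expectation of an inner product *)

Section trace_expectation.
Context {R : realType} {dO : measure_display} {Omega : measurableType dO}.
Variables (P : probability Omega R) (U V : Omega -> L2 R).
Hypotheses (mU : forall f, measurable_fun setT (fun w => inner (U w) f : R))
           (mV : forall f, measurable_fun setT (fun w => inner (V w) f : R))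
           (iU : P.-integrable setT (fun w => (`|U w| ^+ 2)%:E))
           (iV : P.-integrable setT (fun w => (`|V w| ^+ 2)%:E)).

(** By Cauchy-Schwarz the product is dominated by [|f| |g| (|U| ^ 2 + |V| ^ 2)]. *)
Lemma integrable_inner_mul f g :
  P.-integrable setT (fun w => (inner (U w) f * inner (V w) g)%:E).
Proof.
have iUV : P.-integrable setT
    (fun w => ((`|f| * `|g|)%:E * ((`|U w| ^+ 2)%:E + (`|V w| ^+ 2)%:E))%E).
  by apply: integrableZl => //; exact: integrableD.
apply: le_integrable iUV => //.
  by apply/measurable_EFinP; exact: measurable_funM.
move=> w _; rewrite -EFinD -EFinM /= lee_fin normrM.
rewrite [leRHS]ger0_norm; last by rewrite !mulr_ge0// addr_ge0.
apply: (@le_trans _ _ (`|U w| * `|f| * (`|V w| * `|g|))).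
  by apply: ler_pM => //; exact: normr_inner_le.
by rewrite mulrACA mulrC ler_wpM2l ?mulr_ge0// mulr_le_sqrD.
Qed.

(** Projecting [U] onto step functions makes the inner product a finite combination of products of
    expectation zero. Projections do not increase norms, so [|U| ^ 2 + |V| ^ 2] dominates the
    passage to the limit. *)
Lemma expectation_inner_eq0 :
  (forall f g, ('E_P[fun w => (inner (U w) f * inner (V w) g)%R] = 0)%E) ->
  ('E_P[fun w => inner (U w) (V w)] = 0)%E.
Proof.
rewrite unlock => UV0.
pose c n (k : 'I_n.+2) : R := (inner (cell_L2 k) (cell_L2 k))^-1.
pose F n w : R := inner (step_proj n (U w)) (V w).
have FE n w : F n w =
    \sum_(k < n.+2) c n k * (inner (U w) (cell_L2 k) * inner (V w) (cell_L2 k)).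
  rewrite /F /step_proj /orth_proj inner_suml; apply: eq_bigr => k _.
  by rewrite innerZl (innerC (cell_L2 k) (V w)) mulrAC mulrC.
have iF n k : P.-integrable setT (fun w =>
    ((c n k)%:E * (inner (U w) (cell_L2 k) * inner (V w) (cell_L2 k))%:E)%E).
  by apply: integrableZl => //; exact: integrable_inner_mul.
have FE' n : (fun w => (F n w)%:E) = (fun w => \sum_(k < n.+2)
    (c n k)%:E * (inner (U w) (cell_L2 k) * inner (V w) (cell_L2 k))%:E)%E.
  by apply/funext => w; rewrite FE -sumEFin.
have mF n : measurable_fun setT (fun w => (F n w)%:E).
  by rewrite FE'; apply: emeasurable_sum => k; exact: measurable_int (iF n k).
have F0 n : (\int[P]_w (F n w)%:E = 0)%E.
  rewrite FE' integral_sum// big1// => k _.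
  by rewrite integralZl ?UV0 ?mule0//; exact: integrable_inner_mul.
have cF w : (F n w)%:E @[n --> \oo] --> (inner (U w) (V w))%:E.
  apply: cvg_EFin; first exact: nearW.
  apply/cvgrPdist_le => e e0.
  (* The [+ 1] covers [V w = 0]. *)
  have e1 : 0 < e / (`|V w| + 1) by rewrite divr_gt0// ltr_wpDl.
  have /cvg_norm0P /(_ _ e1) := step_proj_cvg (U w).
  apply: filterS => n Un.
  rewrite /F -innerBl; apply: le_trans (normr_inner_le _ _) _.
  apply: (@le_trans _ _ (e / (`|V w| + 1) * (`|V w| + 1))).
    by apply: ler_pM => //; rewrite ?(ltW Un)// lerDl.
  by rewrite divfK// gt_eqF// ltr_wpDl.
(* Only pairings with fixed vectors are assumed measurable; the pairing of [U] with [V] is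
   measurable as a limit of the [F n]. *)
have mUV : measurable_fun setT (fun w => (inner (U w) (V w))%:E).
  by apply: emeasurable_fun_cvg mF _ => w _; exact: cF.
have [|_ _] := @dominated_convergence _ _ _ P setT measurableT
  (fun n w => (F n w)%:E) (fun w => (inner (U w) (V w))%:E)
  (fun w => ((`|U w| ^+ 2)%:E + (`|V w| ^+ 2)%:E)%E) mF mUV
  (aeW _ (fun w _ => cF w)) (integrableD measurableT iU iV) (aeW _ _).
  move=> w n _; rewrite /= -EFinD lee_fin (le_trans (normr_inner_le _ _))//.
  apply: (@le_trans _ _ (`|U w| * `|V w|)); last exact: mulr_le_sqrD.
  by apply: ler_wpM2r => //; exact: norm_orth_proj (@cell_L2_orth _ n) _.
under eq_fun do rewrite F0.
by move=> /(cvg_lim (@ereal_hausdorff R)) <-; rewrite lim_cst.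
Qed.

End trace_expectation.

(** * Measurability, integrability and covariances of L^2-valued variables *)

Section L2_random_variables.
Context {R : realType} {dO : measure_display} {Omega : measurableType dO}.
Variable P : probability Omega R.
Implicit Types (X Y : {RV P >-> L2 R}) (m f g : L2 R).

Lemma continuous_L2_measurable (phi : L2 R -> R) : continuous phi ->
  measurable_fun setT phi.
Proof.
move=> /continuousP cphi; apply: (measurability _ (RGenOpens.measurableE R)).
move=> _ [_ [a [b ->] <-]]; rewrite setTI.
by apply: sub_sigma_algebra; apply: cphi; exact: interval_open.
Qed.

Lemma lipschitz_L2_measurable (phi : L2 R -> R) (K : R) :
  (forall x y, `|phi x - phi y| <= K * `|x - y|) -> measurable_fun setT phi.
Proof.
move=> phiK; apply: continuous_L2_measurable.
move=> x; apply/(@cvgrPdist_lt _ _ _ (nbhs x) (nbhs_filter x)) => e e0.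
(* [|K| + 1] is a positive Lipschitz constant whatever the sign of [K]. *)
have K0 : 0 < `|K| + 1 by rewrite ltr_wpDl.
have e1 : 0 < e / (`|K| + 1) by rewrite divr_gt0.
have := @cvgr_dist_lt _ _ _ (nbhs x) (nbhs_filter x) id x (@cvg_id _ (nbhs x)) _ e1.
apply: (@filterS _ (nbhs x) (nbhs_filter x)) => y xy.
apply: le_lt_trans (phiK _ _) _.
apply: (@le_lt_trans _ _ (`|x - y| * (`|K| + 1))).
  by rewrite mulrC ler_wpM2l// (le_trans (ler_norm _))// lerDl.
by rewrite -ltr_pdivlMr.
Qed.

Lemma measurable_inner_sub m f :
  measurable_fun setT (fun x : L2 R => inner (x - m) f).
Proof.
apply: (@lipschitz_L2_measurable _ `|f|) => x y.
rewrite -innerBl opprB addrA subrK mulrC; exact: normr_inner_le.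
Qed.

Lemma measurable_inner X m f : measurable_fun setT (fun w => inner (X w - m) f).
Proof.
apply: (@measurableT_comp _ _ _ _ _ _ (fun x : L2 R => inner (x - m) f)) => //.
exact: measurable_inner_sub.
Qed.

Lemma measurable_norm_L2 X m : measurable_fun setT (fun w => `|X w - m|).
Proof.
apply: (@measurableT_comp _ _ _ _ _ _ (fun x : L2 R => `|x - m|)) => //.
apply: (@lipschitz_L2_measurable _ 1) => x y.
by rewrite mul1r (le_trans (ler_dist_dist _ _))// opprB addrA subrK.
Qed.

(** The bound is [|X - m| ^ 2 <= 2 |X| ^ 2 + 2 |m| ^ 2]. *)
Lemma integrable_sqr_norm X m : ('E_P[fun w => (`|X w| ^+ 2)%R] < +oo)%E ->
  P.-integrable setT (fun w => (`|X w - m| ^+ 2)%:E).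
Proof.
rewrite unlock => X2.
have mX : measurable_fun setT (fun w => (`|X w| ^+ 2)%:E).
  apply/measurable_EFinP/measurable_funX.
  by have := measurable_norm_L2 X 0; under eq_fun do rewrite subr0.
have iX : P.-integrable setT (fun w => (`|X w| ^+ 2)%:E).
  apply/integrableP; split => //; apply: le_lt_trans X2.
  apply: ge0_le_integral => //; first exact: measurableT_comp.
  by move=> w _; rewrite /= ger0_norm.
have iD : P.-integrable setT
    (fun w => (2%:E * (`|X w| ^+ 2)%:E + (2 * `|m| ^+ 2)%:E)%E).
  apply: integrableD => //; first exact: integrableZl.
  exact: finite_measure_integrable_cst.
apply: le_integrable iD => //.
  by apply/measurable_EFinP/measurable_funX; exact: measurable_norm_L2.
move=> w _; rewrite -EFinM -EFinD /= lee_fin ger0_norm//.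
rewrite ger0_norm ?addr_ge0 ?mulr_ge0//.
have : `|X w - m| ^+ 2 <= (`|X w| + `|m|) ^+ 2.
  by rewrite ler_pXn2r ?nnegrE ?addr_ge0 ?ler_normB.
move=> /le_trans; apply.
have := sqr_ge0 (`|X w| - `|m|); nra.
Qed.

(** The second moment controls the first through [x <= x ^ 2 + 1]. *)
Lemma integrable_inner X m f : ('E_P[fun w => (`|X w| ^+ 2)%R] < +oo)%E ->
  P.-integrable setT (fun w => (inner (X w - m) f)%:E).
Proof.
move=> /(integrable_sqr_norm m) iX.
have iD : P.-integrable setT
    (fun w => (`|f|%:E * ((`|X w - m| ^+ 2)%:E + 1%:E))%E).
  apply: integrableZl => //; apply: integrableD => //.
  exact: finite_measure_integrable_cst.
apply: le_integrable iD => //.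
  by apply/measurable_EFinP; exact: measurable_inner.
move=> w _; rewrite -EFinD -EFinM /= lee_fin [leRHS]ger0_norm; last first.
  by rewrite mulr_ge0// addr_ge0.
apply: le_trans (normr_inner_le _ _) _; rewrite mulrC ler_wpM2l//.
have := sqr_ge0 (`|X w - m| - 1); have := normr_ge0 (X w - m); nra.
Qed.

Lemma trace_cov_eq0 X Y :
  ('E_P[fun w => (`|X w| ^+ 2)%R] < +oo)%E ->
  ('E_P[fun w => (`|Y w| ^+ 2)%R] < +oo)%E ->
  (forall f g,
    ('E_P[fun w => (inner (X w - mean P X) f * inner (Y w - mean P Y) g)%R] = 0)%E) ->
  trace_cov P X Y = 0.
Proof.
move=> X2 Y2 XY0; rewrite /trace_cov (@expectation_inner_eq0 _ _ _ P)//.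
- by move=> f; exact: measurable_inner.
- by move=> f; exact: measurable_inner.
- exact: integrable_sqr_norm.
- exact: integrable_sqr_norm.
Qed.

(** Pairing the weak mean that defines [C f] with [g] turns the operator into scalar covariances. *)
Lemma covop_inner X Y C f g : is_covop P X Y C ->
  ('E_P[fun w => (inner (X w - mean P X) f * inner (Y w - mean P Y) g)%R]
   = (inner (C f) g)%:E)%E.
Proof.
by move=> /(_ f)[_ /(_ g)]; under eq_fun do rewrite innerZl.
Qed.

Lemma expectation_centered X f : (exists m, is_mean P X m) ->
  ('E_P[fun w => (`|X w| ^+ 2)%R] < +oo)%E ->
  ('E_P[fun w => inner (X w - mean P X)%R f] = 0)%E.
Proof.
(* [mean] is selected by [xget], so the existence of some mean yields its defining property. *)
move=> [m Xm] X2; have [_ /(_ f)] : is_mean P X (mean P X) by exact: xgetI Xm.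
rewrite unlock => EX.
under eq_integral do rewrite innerBl EFinB.
rewrite integralB_EFin//.
- have := expectation_cst P (inner (mean P X) f); rewrite unlock => Ec.
  by rewrite EX [X in (_ - X)%E]Ec subee.
- by have := integrable_inner 0 f X2; under eq_fun do rewrite subr0.
- exact: finite_measure_integrable_cst.
Qed.

(** The two factors are measurable functions of [X] and of [Y], so they inherit independence; the
    expectation factors and the centered [Y] contributes [0]. *)
Lemma independent_expectation0 X Y f g : independent_RV P X Y ->
  (exists m, is_mean P Y m) ->
  ('E_P[fun w => (`|X w| ^+ 2)%R] < +oo)%E ->
  ('E_P[fun w => (`|Y w| ^+ 2)%R] < +oo)%E ->
  ('E_P[fun w => (inner (X w - mean P X) f * inner (Y w - mean P Y) g)%R] = 0)%E.
Proof.
move=> XY Ym X2 Y2.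
pose U : {RV P >-> R} := MeasurableFun.Pack (MeasurableFun.Class
  (isMeasurableFun.Build _ _ _ _ _ (measurable_inner X (mean P X) f))).
pose V : {RV P >-> R} := MeasurableFun.Pack (MeasurableFun.Class
  (isMeasurableFun.Build _ _ _ _ _ (measurable_inner Y (mean P Y) g))).
rewrite (@expectationM_independent _ _ _ P U V).
- by rewrite (_ : 'E_P[V] = 0)%E ?mule0//; exact: expectation_centered.
- move=> A B mA mB.
  apply: (XY ((fun x : L2 R => inner (x - mean P X) f) @^-1` A)
             ((fun x : L2 R => inner (x - mean P Y) g) @^-1` B)).
    by rewrite -[X in measurable X]setTI; exact: measurable_inner_sub.
  by rewrite -[X in measurable X]setTI; exact: measurable_inner_sub.
- exact: integrable_inner.
- exact: integrable_inner.
- apply: (@integrable_inner_mul _ _ _ P (fun w => X w - mean P X)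
    (fun w => Y w - mean P Y)).
  + by move=> h; exact: measurable_inner.
  + by move=> h; exact: measurable_inner.
  + exact: integrable_sqr_norm.
  + exact: integrable_sqr_norm.
Qed.

End L2_random_variables.

(** * The trace-covariogram and the effective sample size *)

Lemma enorm_sym (R : realType) d (x y : 'rV[R]_d) : enorm (x - y) = enorm (y - x).
Proof.
by congr Num.sqrt; apply: eq_bigr => i _; rewrite -opprB mxE sqrrN.
Qed.

(** The event that [X i] lies in [A] is the event that the tuple lies in the cylinder over [A]. *)
Lemma independent_tnth (R : realType) (dO d : measure_display)
    (Omega : measurableType dO)
    (P : probability Omega R) (T : measurableType d) n (X : 'I_n -> Omega -> T)
    (d' : measure_display) (T' : measurableType d') (Y : Omega -> T') i :
  independent_RV P (fun w => [tuple X i w | i < n]) Y -> independent_RV P (X i) Y.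
Proof.
move=> XY A B mA mB; have := XY ((@tnth n T)^~ i @^-1` A) B _ mB.
rewrite (_ : _ @^-1` (_ @^-1` A) = X i @^-1` A); last first.
  by apply/seteqP; split => w /=; rewrite tnth_mktuple.
by apply; rewrite -[X in measurable X]setTI; exact: measurable_tnth.
Qed.

Section covariogram.
Context {R : realType} {dO : measure_display} {Omega : measurableType dO}.
Context {P : probability Omega R} {d : nat}.
Variable chi : 'rV[R]_d -> {RV P >-> L2 R}.

Lemma trace_covariogram_independent (s1 s2 : 'rV[R]_d) : isotropic chi ->
  independent_RV P (chi s1) (chi s2) -> trace_covariogram chi (enorm (s1 - s2)) = 0.
Proof.
move=> [[chi2 [m chim] _] [C chiC]] ind.
have C0 f g : inner (C (enorm (s1 - s2)) f) g = 0.
  have := covop_inner f g (chiC s1 s2).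
  by rewrite independent_expectation0//; [move=> [<-]|exists m].
(* The default value is [0] as well. Otherwise the pair [r1], [r2] behind the selected value may
   differ from [s1], [s2], but isotropy gives it the same operator. *)
rewrite /trace_covariogram; case: xgetP => // v _ [r1 [r2 [r12 ->]]].
apply: trace_cov_eq0 => // f g.
by rewrite (covop_inner f g (chiC r1 r2)) r12 C0.
Qed.

Lemma ESS_lt n (s : 'I_n.+1 -> 'rV[R]_d) : (1 <= n)%N ->
  let s' := fun i : 'I_n => s (widen_ord (leqnSn n) i) in
  0 < trace_covariogram chi 0 ->
  (forall h : R, 0 <= h -> 0 <= trace_covariogram chi h) ->
  (forall i, trace_covariogram chi (enorm (s' i - s ord_max)) = 0) ->
  ESS chi s' < ESS chi s.
Proof.
move=> n1 s' sigma0 sigma_ge0 uncor.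
have enorm0 x : enorm (x - x : 'rV[R]_d) = 0.
  by rewrite /enorm big1 ?sqrtr0// => i _; rewrite subrr mxE expr0n.
(* The last row and column are split off: the corner is the value at distance [0], and the cross
   terms vanish, those of the row by [enorm_sym]. *)
rewrite /ESS big_ord_recr/= [X in _ + X]big_ord_recr/= enorm0.
rewrite [X in _ + (X + _)]big1 ?add0r; last first.
  by move=> i _; rewrite enorm_sym uncor.
under [X in _ < _ * (X + _)^-1]eq_bigr do rewrite big_ord_recr/= uncor addr0.
set S := \sum_(i < n) _; set sg := trace_covariogram chi 0 in sigma0 *.
have nS : n%:R * sg <= S.
  rewrite mulr_natl (_ : sg *+ n = \sum_(i < n) sg); last first.
    by rewrite sumr_const card_ord.
  apply: ler_sum => i _.
  rewrite (bigD1 i)//= enorm0 lerDl sumr_ge0// => j _.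
  by rewrite sigma_ge0// sqrtr_ge0.
have n0 : 0 < n%:R :> R by rewrite ltr0n.
have S0 : 0 < S by rewrite (lt_le_trans _ nS)// mulr_gt0.
rewrite ltr_pdivrMr// [ltRHS]mulrAC ltr_pdivlMr ?addr_gt0// -natr1 -subr_gt0.
(* The cross-multiplied difference is [sg * ((2 n + 1) S - n ^ 2 sg)], grouped so that [nS] makes
   the first summand nonnegative while the second is positive. *)
rewrite (_ : _ - _ = sg * (n%:R * (S - n%:R * sg) + (n%:R + 1) * S)); last by ring.
rewrite mulr_gt0// ltr_wpDl ?mulr_ge0 ?subr_ge0 ?(ltW n0)//.
by rewrite mulr_gt0// addr_gt0.
Qed.

End covariogram.

Theorem proposition3p3 (R : realType) (d n : nat) (n_ge1 : (1 <= n)%N)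
    (dO : measure_display) (Omega : measurableType dO) (P : probability Omega R)
    (chi : 'rV[R]_d -> {RV P >-> L2 R}) (chi_isotropic : isotropic chi)
    (sigma0_gt0 : 0 < trace_covariogram chi 0)
    (s : 'I_n.+1 -> 'rV[R]_d)
    (indep : independent_RV P
       (fun w => [tuple chi (s (widen_ord (leqnSn n) i)) w | i < n])
       (chi (s ord_max)))
    (sigma_ge0 : forall h : R, 0 <= h -> 0 <= trace_covariogram chi h) :
  ESS chi (fun i : 'I_n => s (widen_ord (leqnSn n) i)) < ESS chi s.
Proof.
apply: ESS_lt => // i; apply: trace_covariogram_independent => //.
exact: (independent_tnth (X := fun i => chi (s (widen_ord (leqnSn n) i)))).
Qed.
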